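(* Let $\kappa\leq\omega$ be a cardinal, and let $X_\alpha$ be separable metrizable spaces with the Miller property for $\alpha\in\kappa$. Then $\prod_{\alpha\in\kappa}X_\alpha$ (with the product topology) has the Miller property.
   Context: A space is crowded if it is non-empty and has no isolated points. A space $X$ has the Miller property if for every countable crowded $Q\subseteq X$ there exists a crowded $Q'\subseteq Q$ whose closure in $X$ is compact. *)

(* Defs.v *)
From mathcomp Require Import all_boot all_order all_algebra.
From mathcomp Require Import all_classical all_reals.
From mathcomp Require Import topology.

Set Implicit Arguments.
Unset Strict Implicit.
Unset Printing Implicit Defensive.

Local Open Scope classical_set_scope.
Local Open Scope ring_scope.

(* Spaces may be empty: [topologicalType] does not require a point. *)

Definition separable (X : topologicalType) : Prop :=
  exists2 D : set X, countable D & dense D.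

(* Nonnegativity of a metric follows from the three axioms of [is_metric]. *)
Definition is_metric (R : realType) (X : Type) (d : X -> X -> R) : Prop :=
  [/\ forall x y, d x y = 0 <-> x = y,
      forall x y, d x y = d y x
    & forall x y z, d x z <= d x y + d y z].

Definition metrizable (R : realType) (X : topologicalType) : Prop :=
  exists d : X -> X -> R, is_metric d /\
    forall (x : X) (A : set X),
      nbhs x A <-> exists2 e : R, 0 < e & [set y | d x y < e] `<=` A.

(* [isolated A] is the set of isolated points of the subspace [A]. *)
Definition crowded (X : topologicalType) (A : set X) : Prop :=
  A !=set0 /\ isolated A = set0.

Definition miller_property (X : topologicalType) : Prop :=
  forall Q : set X, countable Q -> crowded Q ->
    exists Q' : set X,
      [/\ Q' `<=` Q, crowded Q' & compact (closure Q')].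

(* Main.v *)
Require Import Defs.
From mathcomp Require Import all_boot all_order all_algebra.
From mathcomp Require Import all_classical all_reals.
From mathcomp Require Import topology lra.
Import Order.TTheory GRing.Theory Num.Theory.

(* A fusion argument builds a crowded set by adding points one at a time inside
   a shrinking reservoir, each point being treated infinitely often.

   The key step concerns one continuous map [f : T -> X] with [X] a metrizable
   space with the Miller property: every countable crowded [Q] in [T] contains
   a crowded [Q'] such that [f @` Q'] lies in a compact set. If [f] is constant
   on a nonempty relatively open subset of [Q], take that subset. Otherwise a
   fusion produces a crowded [S] in [Q] on which [f] is an embedding, so that
   the Miller property of [X], applied to [f @` S], pulls back to [S].
   Moreover [Q'] can be made to contain a prescribed point [p] of [Q]: take [p]
   together with such sets inside neighborhoods shrinking to [p].

   In the product, a second fusion shrinks the reservoir at step [n] to one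
   with relatively compact [n]-th projection, while keeping the finitely many
   points chosen so far; Tychonoff's theorem concludes. *)

Set Implicit Arguments.
Unset Strict Implicit.
Unset Printing Implicit Defensive.

Local Open Scope classical_set_scope.

(** * Crowded sets and local bases *)

Definition dense_in_itself (T : topologicalType) (A : set T) : Prop :=
  forall x U, A x -> nbhs x U -> exists y, [/\ A y, U y & y <> x].

Lemma crowdedP (T : topologicalType) (A : set T) :
  crowded A <-> A !=set0 /\ dense_in_itself A.
Proof.
split=> -[A0 Ac]; split=> //.
  move=> x U Ax Ux; apply: contrapT => noy.
  suff : isolated A x by rewrite Ac.
  split; first exact: mem_set.
  exists U => //; apply/seteqP; split=> [y [Uy Ay]|_ ->]; last first.
    by split=> //; exact: nbhs_singleton.
  by apply: contrapT => yx; apply: noy; exists y.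
apply/seteqP; split=> // x [/set_mem Ax [U Ux UA]].
have [y [Ay Uy yx]] := Ac x U Ax Ux.
by apply: yx; have : (U `&` A) y by []; rewrite UA.
Qed.

(** Carrying a decreasing open base at each point, instead of a metric, lets the fusion run in the
    product without choosing a metric there. *)
Definition countable_local_base (T : topologicalType) (B : T -> nat -> set T) :
    Prop :=
  [/\ forall x n, open (B x n),
      forall x n, B x n x,
      forall x m n, (m <= n)%N -> B x n `<=` B x m
    & forall x A, nbhs x A -> exists n, B x n `<=` A].

Lemma countable_local_base_nbhs (T : topologicalType) (B : T -> nat -> set T) :
  countable_local_base B -> forall x n, nbhs x (B x n).
Proof. by case=> oB Bx _ _ x n; apply: open_nbhs_nbhs; split. Qed.

(** * The fusion construction *)

Lemma logn2_infinitely_often (a m : nat) :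
  exists2 n, (m <= n)%N & logn 2 n = a.
Proof.
exists (2 ^ a * m.*2.+1)%N.
  rewrite -[leqLHS]mul1n leq_mul ?expn_gt0 //.
  by rewrite -addnn -addnS leq_addr.
rewrite lognM ?expn_gt0 // pfactorK // lognE /=.
by rewrite dvdn2 /= odd_double /= addn0.
Qed.

(* The conditions [C n p] shrink the reservoir [A] from which all later points
   are drawn, so they are inherited by the final set. The point treated at step
   [n] is number [logn 2 n] of the list, which makes every point be treated
   infinitely often. *)
Lemma fusion (T : topologicalType) (B : T -> nat -> set T)
    (J : seq T -> set T -> Prop) (C : nat -> T -> set T -> Prop)
    (x0 : T) (A0 : set T) :
  countable_local_base B ->
  (forall n p A A', A' `<=` A -> C n p A -> C n p A') ->
  (forall s A, J s A -> forall x, x \in s -> A x) ->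
  (forall n s A p, J s A -> p \in s -> exists q A',
    [/\ A' `<=` A, J (rcons s q) A', B p n q, q <> p & C n p A']) ->
  J [:: x0] A0 ->
  exists R : set T,
    [/\ R `<=` A0, R x0, dense_in_itself R,
        forall n, exists p, C n p R
      & forall p, R p -> forall m, exists2 n, (m <= n)%N & C n p R].
Proof.
move=> [oB Bx Bdec Bbase] CS JS step J0.
pose inv (u : seq T * set T) := J u.1 u.2 /\ x0 \in u.1.
(* After [n] steps the list has [n.+1] entries, so [(size s).-1] is the step number. The default
   [x0] is itself an entry, by [inv]. *)
pose target (s : seq T) := nth x0 s (logn 2 (size s).-1).
have targetP u : inv u -> target u.1 \in u.1.
  move=> [_ x0u]; rewrite /target.
  have [lt|ge] := ltnP (logn 2 (size u.1).-1) (size u.1); first exact: mem_nth.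
  by rewrite nth_default.
pose S := {u : seq T * set T | inv u}.
pose next (u v : S) := exists q,
  [/\ (sval v).1 = rcons (sval u).1 q, (sval v).2 `<=` (sval u).2,
      B (target (sval u).1) (size (sval u).1).-1 q, q <> target (sval u).1
    & C (size (sval u).1).-1 (target (sval u).1) (sval v).2].
have nextP (u : S) : {v : S | next u v}.
  apply: cid; case: u => u invu.
  have [q [A' [A'A JA' Bq qp CA']]] :=
    step (size u.1).-1 _ _ _ invu.1 (targetP _ invu).
  have invv : inv (rcons u.1 q, A').
    by split=> //=; rewrite mem_rcons inE invu.2 orbT.
  by exists (exist _ (rcons u.1 q, A') invv), q.
have inv0 : inv ([:: x0], A0) by split=> //=; rewrite inE.
have [f [f0 fS]] := dependent_choice nextP (exist _ _ inv0).
pose s n := (sval (f n)).1; pose A n := (sval (f n)).2.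
have sz n : size (s n) = n.+1.
  elim: n => [|n IH]; first by rewrite /s f0.
  by have [q [sE _ _ _ _]] := fS n; rewrite /s sE size_rcons [size _]IH.
have sA n x : x \in s n -> A n x.
  by apply: JS; case: (svalP (f n)).
have Amono m n : (m <= n)%N -> A n `<=` A m.
  elim: n => [|n IH]; first by rewrite leqn0 => /eqP ->.
  rewrite leq_eqVlt ltnS => /predU1P[->//|/IH AA].
  by have [q [_ AnS _ _ _]] := fS n; exact: subset_trans AA.
have nthS m n a : (m <= n)%N -> (a < size (s m))%N ->
    nth x0 (s n) a = nth x0 (s m) a.
  move=> + am; elim: n => [|n IH]; first by rewrite leqn0 => /eqP ->.
  rewrite leq_eqVlt ltnS => /predU1P[->//|mn].
  have [q [sE _ _ _ _]] := fS n; rewrite -(IH mn) {1}/s sE nth_rcons.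
  rewrite sz in am; rewrite [size _]sz ifT //.
  exact: leq_trans am _.
have smono m n x : (m <= n)%N -> x \in s m -> x \in s n.
  move=> mn xm; rewrite -(nth_index x0 xm) -(nthS m n) ?index_mem //.
  apply: mem_nth; rewrite sz; apply: leq_trans (mn : (m < n.+1)%N).
  by rewrite -(sz m) index_mem.
pose R := [set x | exists n, x \in s n].
(* A point listed by step [n] lies in [A n] since lists only grow; a point listed later lies in a
   smaller reservoir. *)
have RA n : R `<=` A n.
  move=> x [m xm]; have [mn|/ltnW nm] := leqP m n.
    by apply: sA; exact: smono xm.
  by apply: (Amono _ _ nm); exact: sA.
have targetE p m : R p -> exists2 n, (m <= n)%N & target (s n) = p.
  move=> [k pk].
  (* Entries keep their position as the list grows, so once listed, [p] is treated at every step
     whose 2-adic valuation is its index. *)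
  have [n kmn na] := logn2_infinitely_often (index p (s k)) (maxn k m).
  exists n; first exact: leq_trans (leq_maxr _ _) kmn.
  rewrite /target sz /= na (nthS k) ?index_mem ?nth_index //.
  exact: leq_trans (leq_maxl _ _) kmn.
have CR n : C n (target (s n)) R.
  have [q [_ _ _ _]] := fS n; rewrite [size _]sz /= => Cn.
  exact: CS (RA n.+1) Cn.
exists R; split.
- by have := RA 0; rewrite /A f0.
- by exists 0; rewrite /s f0 /= inE.
- move=> p U Rp /Bbase[m BU].
  have [n mn tn] := targetE p m Rp.
  have [q [sE _ Bq qp _]] := fS n; exists q; split; last by rewrite -tn.
    by exists n.+1; rewrite /s sE mem_rcons inE eqxx.
  apply: BU; apply: (Bdec _ _ _ mn).
  by move: Bq; rewrite [size _]sz [target _]tn.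
- by move=> n; exists (target (s n)).
- by move=> p Rp m; have [n mn <-] := targetE p m Rp; exists n.
Qed.
Local Open Scope ring_scope.

(** * Metric spaces *)

Section metric.
Context (R : realType) (X : topologicalType) (d : X -> X -> R).
Hypothesis dm : is_metric d.
Hypothesis dnbhs : forall (x : X) (A : set X),
  nbhs x A <-> exists2 e : R, 0 < e & [set y | d x y < e] `<=` A.

Let dxx x : d x x = 0. Proof. by case: dm => d0 _ _; apply/d0. Qed.

Let dsym x y : d x y = d y x. Proof. by case: dm. Qed.

Let dtri x y z : d x z <= d x y + d y z. Proof. by case: dm. Qed.

Lemma metric_gt0 x y : x <> y -> 0 < d x y.
Proof.
move=> xy; rewrite lt_def; apply/andP; split.
  by case: dm => d0 _ _; apply/eqP => /d0.
have := dtri x y x; rewrite dxx (dsym y x); lra.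
Qed.

Lemma open_metric_ball x e : open [set y | d x y < e].
Proof.
rewrite openE => y /= xye; apply/dnbhs; exists (e - d x y); first lra.
by move=> z /= yz; have := dtri x y z; lra.
Qed.

Lemma open_metric_far x e : open [set y | e < d x y].
Proof.
rewrite openE => y /= xye; apply/dnbhs; exists (d x y - e); first lra.
by move=> z /= yz; have := dtri x z y; rewrite (dsym z y); lra.
Qed.

Lemma metric_hausdorff_space : hausdorff_space X.
Proof.
move=> x y xy; apply: contrapT => /metric_gt0 d0.
have hx z : nbhs z [set w | d z w < d x y / 2].
  by apply/dnbhs; exists (d x y / 2) => //; lra.
have [z [/= xz yz]] := xy _ _ (hx x) (hx y).
by have := dtri x z y; rewrite (dsym z y); lra.
Qed.

Lemma metric_local_base :
  countable_local_base (fun x n => [set y | d x y < n.+1%:R^-1]).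
Proof.
split=> [x n|x n /=|x m n mn y /=|x A].
- exact: open_metric_ball.
- by rewrite dxx invr_gt0.
- move=> /lt_le_trans; apply; rewrite lef_pV2 ?posrE // ler_nat ltnS.
  exact: mn.
- move=> /dnbhs[e e0 eA].
  have [n] := ltr_add_invr e0; rewrite add0r => ne.
  by exists n => y /= xy; apply: eA; exact: lt_trans ne.
Qed.

(** The strict inequality matters: the points farther than [e] from [x] form an open set, which
    contains every entry of [s] other than [x]. *)
Lemma metric_separation (x : X) (s : seq X) :
  exists2 e : R, 0 < e & forall y, y \in s -> y <> x -> e < d x y.
Proof.
elim: s => [|z s [e e0 es]]; first by exists 1.
have [->|/eqP zx] := eqVneq z x.
  by exists e => // y; rewrite inE => /predU1P[->//|]; exact: es.
have xz0 : 0 < d x z by apply: metric_gt0 => xz; exact: zx.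
exists (Num.min e (d x z / 2)); first by rewrite lt_min e0 /=; lra.
move=> y; rewrite inE gt_min => /predU1P[->|ys yx].
  by move=> _; apply/orP; right; lra.
by rewrite es.
Qed.

End metric.

(** A filter that does not cluster at [x] has a member missing some neighborhood of [x]. That
    neighborhood contains all but finitely many [K n], so the filter lives on a finite union of
    compact sets. *)
Lemma compact_bigcup_cvg (X : topologicalType) (x : X) (K : nat -> set X) :
  (forall n, compact (K n)) ->
  (forall U, nbhs x U -> exists N, forall n, (N <= n)%N -> K n `<=` U) ->
  compact ([set x] `|` \bigcup_n K n).
Proof.
move=> cK Kx F FF FK.
have [Fx|] := pselect (cluster F x); first by exists x; split=> //; left.
move=> /existsNP[A /existsNP[U /not_implyP[FA /not_implyP[Ux AU]]]].
have [N KU] := Kx U Ux.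
have [|y [Ky Fy]] := @bigsetU_compact X 'I_N (fun i => K i)
    (index_enum 'I_N) xpredT (fun i _ => cK i) F FF.
  rewrite -bigcup_mkord; apply: filterS (filterI FA FK) => z [Az [zx|[n _ Knz]]].
    by case: AU; exists z; split=> //; rewrite zx; exact: nbhs_singleton.
  exists n => //=; rewrite ltnNge; apply/negP => Nn.
  by case: AU; exists z; split=> //; exact: KU Knz.
exists y; split=> //; right.
by move: Ky; rewrite -bigcup_mkord => -[n _ Kny]; exists n.
Qed.

(** * One continuous map into a metrizable space with the Miller property *)

Section projection.
Context (R : realType) (X : topologicalType) (d : X -> X -> R).
Hypothesis dm : is_metric d.
Hypothesis dnbhs : forall (x : X) (A : set X),
  nbhs x A <-> exists2 e : R, 0 < e & [set y | d x y < e] `<=` A.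
Context (T : topologicalType) (B : T -> nat -> set T) (f : T -> X).
Hypothesis Bb : countable_local_base B.
Hypothesis hT : hausdorff_space T.
Hypothesis fc : continuous f.

(** When [q] is added near [p], the reservoir loses the points outside [B p n] whose image is within
    [e] of [f p]. Since [p] is treated infinitely often, closeness of images to [f p] ends up
    forcing closeness to [p]. *)
Lemma nowhere_locally_constant_embedding (Q : set T) :
  Q !=set0 ->
  (forall p U, Q p -> nbhs p U -> exists q, [/\ Q q, U q & f q <> f p]) ->
  exists S : set T, [/\ S `<=` Q, S !=set0, dense_in_itself S
    & forall p U, S p -> nbhs p U ->
        exists2 V, nbhs (f p) V & forall q, S q -> V (f q) -> U q].
Proof.
move=> [x0 Qx0] Qnc.
have [oB Bx _ Bbase] := Bb.
pose J (s : seq T) (A : set T) :=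
  [/\ forall x, x \in s -> A x,
      forall p U, A p -> nbhs p U -> exists q, [/\ A q, U q & f q <> f p]
    & forall x y, x \in s -> y \in s -> f x = f y -> x = y].
pose C n p (A : set T) :=
  exists2 e : R, 0 < e & forall q, A q -> d (f p) (f q) < e -> B p n q.
have [] := @fusion T B J C x0 Q Bb.
- by move=> n p A A' AA [e e0 eA]; exists e => // q /AA; exact: eA.
- by move=> s A [].
- move=> n s A p [sA Anc finj] ps.
  have [e e0 es] := metric_separation dm (f p) (map f s).
  pose O := f @^-1` [set y | e < d (f p) y] `|` B p n.
  have oO : open O.
    apply: openU; last exact: oB.
    by move/continuousP: fc; apply; exact: open_metric_far.
  have Up : nbhs p (f @^-1` [set y | d (f p) y < e] `&` B p n).
    apply: filterI; last exact: countable_local_base_nbhs.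
    by apply: fc; apply/dnbhs; exists e.
  have [q [Aq [/= qe Bq] fqp]] := Anc p _ (sA _ ps) Up.
  (* Images of listed points equal [f p] or are farther than [e] from it; [f q] is neither. *)
  have qs x : x \in s -> f x <> f q.
    move=> xs xq; have [xp|/eqP xp] := eqVneq (f x) (f p).
      by apply: fqp; rewrite -xq.
    have : e < d (f p) (f x) by apply: es => //; exact: map_f.
    by rewrite xq => /lt_trans /(_ qe); rewrite ltxx.
  exists q, (A `&` O); split=> //; last 2 first.
  + by move=> qp; apply: fqp; rewrite qp.
  + exists e => // r [_ [/= er|//]] re.
    by have := lt_trans er re; rewrite ltxx.
  split.
  (* The cut keeps the listed points: [p] and [q] lie in [B p n], and by injectivity the others have
     images farther than [e] from [f p]. *)
  + move=> x; rewrite mem_rcons inE => /predU1P[->|xs]; first by split=> //; right.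
    split; first exact: sA.
    have [->|/eqP xp] := eqVneq x p; first by right; exact: Bx.
    left; apply: es; first exact: map_f.
    by move=> /(finj _ _ xs ps).
  + move=> x U [Ax Ox] Ux.
    have /(Anc _ _ Ax)[r [Ar [Ur Or] rx]] : nbhs x (U `&` O).
      by apply: filterI => //; apply: open_nbhs_nbhs.
    by exists r.
  + move=> x y; rewrite !mem_rcons !inE => /predU1P[->|xs] /predU1P[->|ys] //.
    * by move=> xy; case: (qs y).
    * by move=> /(qs _ xs).
    * exact: finj.
- split=> //; first by move=> x; rewrite inE => /eqP ->.
  by move=> x y; rewrite !inE => /eqP -> /eqP ->.
- move=> S [SQ Sx0 Sdii _ CS]; exists S; split=> //; first by exists x0.
  move=> p U Sp /Bbase[m BU].
  have [n mn [e e0 eS]] := CS p Sp m.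
  exists [set y | d (f p) y < e]; first by apply/dnbhs; exists e.
  move=> q Sq /= qe; apply: BU; have [_ _ Bdec _] := Bb.
  by apply: (Bdec _ _ _ mn); exact: eS.
Qed.

Hypothesis Xm : miller_property X.

Lemma crowded_compact_image (Q : set T) :
  countable Q -> crowded Q ->
  exists Q' K, [/\ Q' `<=` Q, crowded Q', compact K & f @` Q' `<=` K].
Proof.
move=> cQ /crowdedP[Q0 Qdii].
have [Qnc|] := pselect (forall p U, Q p -> nbhs p U ->
    exists q, [/\ Q q, U q & f q <> f p]); last first.
  move=> /existsNP[p /existsNP[U /not_implyP[Qp /not_implyP[Up Uc]]]].
  have [W [oW Wp] WU] : exists2 W, open_nbhs p W & W `<=` U.
    by move: Up; rewrite nbhsE => -[W ? ?]; exists W.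
  exists (Q `&` W), [set f p]; split.
  - by move=> x [].
  - apply/crowdedP; split; first by exists p.
    move=> x V [Qx Wx] Vx.
    have /(Qdii _ _ Qx)[y [Qy [Vy Wy] yx]] : nbhs x (V `&` W).
      by apply: filterI => //; exact: open_nbhs_nbhs.
    by exists y.
  - exact: compact_set1.
  - move=> _ [x [Qx Wx] <-] /=; apply: contrapT => xp.
    by apply: Uc; exists x; split=> //; exact: WU.
have [S [SQ [x0 Sx0] Sdii Semb]] := nowhere_locally_constant_embedding Q0 Qnc.
have cfS : countable (f @` S).
  apply: sub_countable (card_image_le f S) _.
  exact: sub_countable (subset_card_le SQ) cQ.
have crfS : crowded (f @` S).
  apply/crowdedP; split; first by exists (f x0), x0.
  move=> _ V [p Sp <-] Vp.
  have [q [Sq Vq qp]] := Sdii p _ Sp (fc Vp).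
  exists (f q); split=> //.
  (* If [f q = f p], the embedding property puts [q] in every neighborhood of [p], so the Hausdorff
     property gives [q = p]. *)
  move=> fqp; apply: qp; apply: hT => U W Uq Wp.
  have [V' V'p V'W] := Semb p W Sp Wp.
  exists q; split; first exact: nbhs_singleton.
  by apply: V'W => //; rewrite fqp; exact: nbhs_singleton.
have [P [PfS /crowdedP[[y Py] Pdii] cP]] := Xm cfS crfS.
(* Crowdedness of [P] passes to its preimage in [S] because the inverse of [f] is continuous on the
   image of [S]. *)
exists (S `&` f @^-1` P), (closure P); split=> //.
- by move=> x [/SQ].
- apply/crowdedP; split.
    by have [x Sx xy] := PfS y Py; exists x; split=> //=; rewrite xy.
  move=> x U [Sx Px] Ux; have [V Vx VU] := Semb x U Sx Ux.
  have [w [Pw Vw wx]] := Pdii (f x) V Px Vx.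
  have [z Sz zw] := PfS w Pw; rewrite -zw in Pw Vw wx.
  exists z; split; [by split; last by []|exact: VU|].
  by move=> zx; apply: wx; rewrite zx.
- by move=> _ [x [_ Px] <-]; exact: subset_closure.
Qed.

Lemma crowded_compact_image_point (Q : set T) (p : T) :
  countable Q -> dense_in_itself Q -> Q p ->
  exists Q' K, [/\ Q' `<=` Q, Q' p, dense_in_itself Q', compact K
    & f @` Q' `<=` K].
Proof.
move=> cQ Qdii Qp; have [oB Bx _ Bbase] := Bb.
have [oD Dx Ddec Dbase] := metric_local_base dm dnbhs.
pose D n := [set y : X | d (f p) y < n.+1%:R^-1].
pose W n := B p n `&` f @^-1` D n.
have oW n : open (W n).
  by apply: openI => //; move/continuousP: fc; apply; exact: oD.
have WP n : {QK : set T * set X | [/\ QK.1 `<=` Q `&` W n, crowded QK.1,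
    compact QK.2 & f @` QK.1 `<=` QK.2]}.
  apply: cid; have [||Q' [K H]] := @crowded_compact_image (Q `&` W n).
  - by apply: sub_countable cQ; apply: subset_card_le => x [].
  - apply/crowdedP; split.
      by exists p; split=> //; split; [exact: Bx|exact: Dx].
    move=> x V [Qx Wx] Vx.
    have /(Qdii _ _ Qx)[y [Qy [Vy Wy] yx]] : nbhs x (V `&` W n).
      by apply: filterI => //; exact: open_nbhs_nbhs.
    by exists y.
  - by exists (Q', K).
pose Qn n := (sval (WP n)).1.
(* Cutting by the closed ball of radius [n.+1%:R^-1] keeps compactness and makes these sets converge
   to [f p]. *)
pose Kn n := (sval (WP n)).2 `&` ~` [set y | n.+1%:R^-1 < d (f p) y].
have QnQW n : Qn n `<=` Q `&` W n by have [] := svalP (WP n).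
have Qn_crowded n : crowded (Qn n) by have [] := svalP (WP n).
have fQn n : f @` Qn n `<=` Kn n.
  move=> y fy; split; first by have [_ _ _] := svalP (WP n); exact.
  case: fy => x /QnQW[_ [_ /= xn]] <-.
  by move=> /(lt_trans xn); rewrite ltxx.
exists ([set p] `|` \bigcup_n Qn n), ([set f p] `|` \bigcup_n Kn n); split.
- by move=> x [->|[n _ /QnQW[]]].
- by left.
- move=> x U [->|[n _ Qnx]] Ux.
    have [m BU] := Bbase _ _ Ux.
    have /crowdedP[[y Qy] Qmdii] := Qn_crowded m.
    (* A crowded set has at least two points, so one differs from [p]. *)
    have [z [Qz zp]] : exists z, Qn m z /\ z <> p.
      have [->|/eqP yp] := eqVneq p y; last by exists y; split=> // /esym.
      have [z [Qz _ zy]] := Qmdii y setT Qy filterT.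
      by exists z.
    exists z; split=> //; first by right; exists m.
    by apply: BU; have [_ []] := QnQW _ _ Qz.
  have /crowdedP[_ Qndii] := Qn_crowded n.
  have [y [Qy Uy yx]] := Qndii x U Qnx Ux.
  by exists y; split=> //; right; exists n.
- apply: compact_bigcup_cvg => [n|U /dnbhs[e e0 eU]].
    apply: compact_closedI; first by have [] := svalP (WP n).
    by apply: open_closedC; exact: open_metric_far.
  have [N] := ltr_add_invr e0; rewrite add0r => Ne.
  exists N => n Nn y [_ /= /negP]; rewrite -leNgt => yn.
  apply: eU => /=; apply: le_lt_trans yn _; apply: le_lt_trans Ne.
  by rewrite lef_pV2 ?posrE // ler_nat ltnS.
- move=> _ [x [->|[n _ Qnx]] <-]; first by left.
  by right; exists n => //; apply: fQn; exists x.
Qed.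

(** Take the union of the sets obtained for the single entries. Since [dense_in_itself] allows the
    empty set, the empty list is a valid base case. *)
Lemma crowded_compact_image_seq (Q : set T) (s : seq T) :
  countable Q -> dense_in_itself Q -> (forall x, x \in s -> Q x) ->
  exists Q' K, [/\ Q' `<=` Q, forall x, x \in s -> Q' x, dense_in_itself Q',
    compact K & f @` Q' `<=` K].
Proof.
move=> cQ Qdii; elim: s => [|p s IH] sQ.
  exists set0, set0; split=> //; first exact: compact0.
  by rewrite image_set0.
have [|Q1 [K1 [Q1Q sQ1 Q1dii cK1 fQ1]]] := IH.
  by move=> x xs; apply: sQ; rewrite inE xs orbT.
have [|Q2 [K2 [Q2Q Q2p Q2dii cK2 fQ2]]] := @crowded_compact_image_point Q p cQ Qdii.
  by apply: sQ; rewrite inE eqxx.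
exists (Q1 `|` Q2), (K1 `|` K2); split.
- by move=> x [/Q1Q|/Q2Q].
- by move=> x; rewrite inE => /predU1P[->|/sQ1]; [right|left].
- move=> x U [Qx|Qx] Ux.
    by have [y [Qy Uy yx]] := Q1dii x U Qx Ux; exists y; split=> //; left.
  by have [y [Qy Uy yx]] := Q2dii x U Qx Ux; exists y; split=> //; right.
- exact: compactU.
- by rewrite image_setU; exact: setUSS.
Qed.

End projection.

(** * Countable products *)

Lemma product_local_base (I : choiceType) (X : I -> topologicalType)
    (g : I -> nat) (B : forall i, X i -> nat -> set (X i)) :
  injective g -> (forall i, countable_local_base (B i)) ->
  countable_local_base (fun (x : prod_topology X) n =>
    [set y : prod_topology X | forall i, (g i <= n)%N -> B i (x i) n (y i)]).
Proof.
move=> ginj Bb; split=> [x n|x n i _|x m n mn y /= yB i im|x A].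
(* As [g] is injective, only finitely many coordinates are constrained, which gives openness. *)
- have : finite_set [set i | (g i <= n)%N].
    apply: (@finite_preimage _ _ `I_n.+1 g) => //.
    by move=> i j _ _; exact: ginj.
  move=> /finite_fsetP[D DE].
  have -> : [set y : prod_topology X | forall i, (g i <= n)%N ->
        B i (x i) n (y i)] =
      \bigcap_(i in [set i | (g i <= n)%N]) proj i @^-1` B i (x i) n.
    by apply/seteqP; split=> y yB i gi; exact: yB.
  rewrite openE => y yB; rewrite DE; apply: filter_bigI => i iD.
  have {iD} gi : [set i | (g i <= n)%N] i by rewrite DE.
  apply: (@proj_continuous I X i y); apply: open_nbhs_nbhs.
  by have [oB _ _ _] := Bb i; split; [exact: oB|exact: yB].
- by have [_ Bx _ _] := Bb i; exact: Bx.
- have [_ _ Bdec _] := Bb i; apply: (Bdec _ _ _ mn).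
  by apply: yB; exact: leq_trans mn.
- pose P n := [set y : prod_topology X |
    forall i, (g i <= n)%N -> B i (x i) n (y i)].
  have Pdec m n : (m <= n)%N -> P n `<=` P m.
    move=> mn y Pny i im; have [_ _ Bdec _] := Bb i; apply: (Bdec _ _ _ mn).
    by apply: Pny; exact: leq_trans mn.
  have FP : Filter (filter_from [set: nat] P).
    apply: filter_from_filter; first by exists 0%N.
    move=> i j _ _; exists (maxn i j) => // y Py.
    by split; apply: Pdec Py; rewrite ?leq_maxl ?leq_maxr.
  (* The product topology is a supremum of initial topologies, so convergence is checked one
     coordinate at a time. *)
  have : filter_from [set: nat] P --> (x : prod_topology X).
    apply/cvg_sup => i C [_ [[O oO <-] Oxi OC]].
    have [_ _ Bdec Bbase] := Bb i.
    have [m BO] : exists m, B i (x i) m `<=` O.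
      by apply: Bbase; apply: open_nbhs_nbhs.
    (* Being at least [g i], this index constrains coordinate [i]; being at least [m], it constrains
       it to [O]. *)
    exists (maxn m (g i)) => // y Py; apply: OC; apply: BO.
    by apply: (Bdec _ _ _ (leq_maxl m (g i))); apply: Py; exact: leq_maxr.
  by move=> /[apply] -[n _ PA]; exists n.
Qed.

Lemma miller_property_product (R : realType) (I : choiceType)
    (X : I -> topologicalType) :
  countable [set: I] -> (forall i, metrizable R (X i)) ->
  (forall i, miller_property (X i)) -> miller_property (prod_topology X).
Proof.
move=> /countable_injP[g ginj] Xmet Xmil Q cQ /crowdedP[[x0 Qx0] Qdii].
have {}ginj : injective g.
  by move=> i j; apply: ginj; rewrite inE.
pose d i := sval (cid (Xmet i)); have dP i := svalP (cid (Xmet i)).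
pose T : topologicalType := prod_topology X.
have Xhaus i : hausdorff_space (X i).
  by have [di dn] := dP i; exact: metric_hausdorff_space di dn.
have hT : hausdorff_space T by exact: hausdorff_product.
have Bb := product_local_base ginj
  (fun i => metric_local_base (dP i).1 (dP i).2).
set B := (fun _ _ => _) in Bb.
pose J (s : seq T) (A : set T) :=
  [/\ forall x, x \in s -> A x, dense_in_itself A & A `<=` Q].
(* At most one coordinate has number [n]; if none has, the condition is vacuous. *)
pose C n (p : T) (A : set T) := forall i, g i = n ->
  exists2 K : set (X i), compact K & proj i @` A `<=` K.
have [] := @fusion T B J C x0 Q Bb.
- move=> n p A A' AA CA i /CA[K cK AK]; exists K => //.
  by apply: subset_trans AK; exact: image_subset.
- by move=> s A [].
- move=> n s A p [sA Adii AQ] ps.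
  have cA : countable A by exact: sub_countable (subset_card_le AQ) cQ.
  have [A' [AA sA' Adii' CA]] : exists A' : set T, [/\ A' `<=` A,
      forall x, x \in s -> A' x, dense_in_itself A' & C n p A'].
    have [[i gi]|noi] := pselect (exists i, g i = n); last first.
      by exists A; split=> // i gi; case: noi; exists i.
    have [A' [K [AA sA' Adii' cK AK]]] := crowded_compact_image_seq
      (dP i).1 (dP i).2 Bb hT (@proj_continuous _ X i) (Xmil i) cA Adii sA.
    exists A'; split=> // j gj; have ij : i = j by apply: ginj; rewrite gi.
    by subst j; exists K.
  have [q [Aq Bq qp]] := Adii' p _ (sA' p ps) (countable_local_base_nbhs Bb p n).
  exists q, A'; split=> //; split=> //; last exact: subset_trans AQ.
  by move=> x; rewrite mem_rcons inE => /predU1P[->//|/sA'].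
- by split=> // x; rewrite inE => /eqP ->.
- move=> S [SQ Sx0 Sdii CS _]; exists S; split=> //.
    by apply/crowdedP; split=> //; exists x0.
  (* The fusion gives [C n] for every [n]; taking [n] to be [g i] bounds coordinate [i]. *)
  have SC i : {K : set (X i) | compact K & proj i @` S `<=` K}.
    by apply: cid2; have [p /(_ i erefl)[K cK SK]] := CS (g i); exists K.
  pose K i := s2val (SC i).
  have cK : @compact T [set y | forall i, K i (y i)].
    by apply: tychonoff => i; exact: s2valP.
  have SK : S `<=` [set y | forall i, K i (y i)].
    by move=> y Sy i; apply: (s2valP' (SC i)); exists y.
  apply: (subclosed_compact (@closed_closure _ _) cK).
  have /closure_id KE := compact_closed hT cK.
  by move=> y /(closureS SK); rewrite -KE.
Qed.

Theorem theorem8p2 (R : realType) (I : Type) (X : I -> topologicalType)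
    (hI : countable [set: I])
    (hsep : forall i : I, separable (X i))
    (hmet : forall i : I, metrizable R (X i))
    (hmil : forall i : I, miller_property (X i)) :
  miller_property (prod_topology X).
(* Classical choice turns the arbitrary index type into a [choiceType]. *)
Proof. exact: (@miller_property_product R {classic I} X). Qed.
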